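(* For a non-autonomous discrete dynamical system $(X,f_{1,\infty})$ the following are equivalent: (i) The system $(X,f_{1,\infty})$ is topologically mixing. (ii) For every pair of opene subsets $U,V\subset X$, $N(U,V)$ is co-finite (in $\mathbb{N}$). (iii) For every opene subset $U\subset X$ and every $\epsilon>0$, there exists $N\in\mathbb{N}$ such that $f_1^{-n}(U)$ is $\epsilon$ dense in $X$ for all $n\geq N$. (iv) For every opene subset $U\subset X$ and every $\epsilon>0$, there exists $N\in\mathbb{N}$ such that $f_1^{n}(U)$ is $\epsilon$ dense in $X$ for all $n\geq N$.
   Context: $\mathbb{N}=\{1,2,3,\dots\}$. A non-autonomous discrete dynamical system (NDDS) is a pair $(X,f_{1,\infty})$ where $X$ is a compact metric space and $f_{1,\infty}=(f_n)_{n\in\mathbb{N}}$ is a sequence of continuous maps $f_n:X\to X$. For $n\in\mathbb{N}$, $f_1^n:=f_n\circ\cdots\circ f_1$, and $f_1^{-n}(A)=(f_1^n)^{-1}(A)$ denotes the preimage. ''Opene'' means nonempty and open. $N(U,V)=\{n\in\mathbb{N}: f_1^n(U)\cap V\neq\emptyset\}$. The system is topologically mixing if for every pair of opene subsets $U,V\subset X$ there exists $k\in\mathbb{N}$ such that $f_1^n(U)\cap V\neq\emptyset$ for all $n\geq k$. For $\epsilon>0$, a subset of $X$ is $\epsilon$ dense if it intersects every open ball of radius $\epsilon$ in $X$. *)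

(* Defs.v *)
From HB Require Import structures.
From mathcomp Require Import all_boot all_order all_algebra.
From mathcomp Require Import all_classical all_reals all_analysis.

Set Implicit Arguments.
Unset Strict Implicit.
Unset Printing Implicit Defensive.

Local Open Scope classical_set_scope.
Local Open Scope ring_scope.

(* The natural numbers start at 1. A sequence (f_n)_{n >= 1} is a function on
   nat whose value at 0 is never used. *)
Definition posnat : set nat := [set n | (0 < n)%N].

Definition opene (T : topologicalType) (U : set T) : Prop :=
  open U /\ U !=set0.

Definition is_NDDS (R : realType) (X : metricType R) (f : nat -> X -> X) :
    Prop :=
  compact [set: X] /\ forall n, posnat n -> continuous (f n).

(* f_1^n = f_n \o ... \o f_1; the value at n = 0 is only the base case. *)
Fixpoint evol (T : Type) (f : nat -> T -> T) (n : nat) : T -> T :=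
  if n is m.+1 then f n \o evol f m else id.

Definition hitting_times (T : Type) (f : nat -> T -> T) (U V : set T) :
    set nat :=
  [set n | posnat n /\ (evol f n @` U) `&` V !=set0].

Definition topologically_mixing (T : topologicalType) (f : nat -> T -> T) :
    Prop :=
  forall U V : set T, opene U -> opene V ->
    exists k, posnat k /\
      forall n, (k <= n)%N -> (evol f n @` U) `&` V !=set0.

Definition cofinite_in_posnat (A : set nat) : Prop :=
  finite_set (posnat `\` A).

Definition eps_dense (R : realType) (X : metricType R) (e : R) (A : set X) :
    Prop :=
  forall x : X, A `&` ball x e !=set0.

(* Main.v *)
(* Mixing says that for opene U and V the sets f_1^n(U) eventually meet V, or
   equivalently that the f_1^-n(V) eventually meet U.  By compactness of X, a
   sequence of sets eventually meets every opene set if and only if, for each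
   e > 0, its members are eventually e dense; (iii) and (iv) are this
   equivalence for preimages and images respectively. *)
Require Import Defs.
From HB Require Import structures.
From mathcomp Require Import all_boot all_order all_algebra.
From mathcomp Require Import all_classical all_reals all_analysis.

Import Num.Theory.

Local Open Scope classical_set_scope.
Local Open Scope ring_scope.

(** Turns positive thresholds into filter statements at infinity; raising a threshold by one makes
    it positive. *)
Lemma eventually_posnatP (P : nat -> Prop) :
  (exists N, posnat N /\ forall n, (N <= n)%N -> P n) <->
  \forall n \near \oo, P n.
Proof.
split=> [[N [_ PN]]|[N _ PN]]; first by exists N.
by exists N.+1; split=> // n /ltnW; exact: PN.
Qed.

Lemma cofinite_in_posnatP (A : set nat) :
  cofinite_in_posnat A <-> \forall n \near \oo, A n.
Proof.
split=> [/finite_seqP[s sE]|[N _ AN]].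
  (* [s] lists the exceptional times. None exceeds their maximum, and the successor also forces [n]
     to be positive, hence in [posnat]. *)
  exists (\max_(i <- s) i).+1 => // n /= sn; apply: contrapT => nA.
  have : (posnat `\` A) n by split=> //; exact: leq_trans sn.
  by rewrite sE /= => /(@leq_bigmax_seq nat s predT id n)/(_ isT);
     rewrite leqNgt sn.
apply: (sub_finite_set _ (finite_II N)) => n [_ nA] /=.
by rewrite ltnNge; apply/negP => /AN.
Qed.

Lemma setI_preimage_nonempty (T T' : Type) (g : T -> T') (U : set T)
    (V : set T') :
  (g @` U) `&` V !=set0 <-> (g @^-1` V) `&` U !=set0.
Proof.
split=> [[_ [[x Ux <-] Vgx]]|[x [Vgx Ux]]]; first by exists x.
by exists (g x); split=> //; exists x.
Qed.

Lemma opene_interior_ball (R : realType) (X : metricType R) (x : X) (e : R) :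
  0 < e -> opene (ball x e)^°.
Proof.
by move=> e0; split; [exact: open_interior|exists x; exact: nbhsx_ballx].
Qed.

(** Left to right, [V] contains a ball. Right to left, all centres near a given point share one
    threshold, and compactness, as near-covering, merges these local thresholds into one. *)
Lemma eventually_eps_denseP (R : realType) (X : metricType R)
    (E : nat -> set X) : compact [set: X] ->
  (forall e : R, 0 < e -> \forall n \near \oo, eps_dense e (E n)) <->
  (forall V, opene V -> \forall n \near \oo, E n `&` V !=set0).
Proof.
move=> cX; split=> [dE V [oV [x Vx]]|mE e e0].
  have /nbhs_ballP[e /= e0 xeV] : nbhs x V by exact: open_nbhs_nbhs.
  apply: filterS (dE _ e0) => n /(_ x)[y [Ey xy]].
  by exists y; split=> //; exact: xeV.
have e20 : 0 < e / 2 by rewrite divr_gt0.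
have covX : near_covering [set: X] by exact/compact_near_coveringP.
have := covX _ \oo (fun n x => E n `&` ball x e !=set0) _.
case=> [x _|N N0 NE]; last by exists N => // n /NE h x; exact: h.
(* With radius [e / 2], one opene set serves every centre [x'] in [ball x (e / 2)]: a point of [E n]
   in that ball lies in [ball x' e]. *)
exists (ball x (e / 2), [set n | E n `&` (ball x (e / 2))^° !=set0]).
  by split; [exact: nbhsx_ballx|exact: mE (opene_interior_ball _ _ _ _ e20)].
move=> [x' n] /= [xx' [y [Ey /interior_subset xy]]].
by exists y; split=> //; exact: ball_splitr xx' xy.
Qed.

Theorem theorem3p10 (R : realType) (X : metricType R) (f : nat -> X -> X)
    (hf : is_NDDS f) :
  [<-> topologically_mixing f;
       forall U V : set X, opene U -> opene V ->
         cofinite_in_posnat (hitting_times f U V);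
       forall (U : set X) (e : R), opene U -> 0 < e ->
         exists N, posnat N /\
           forall n, (N <= n)%N -> eps_dense e (evol f n @^-1` U);
       forall (U : set X) (e : R), opene U -> 0 < e ->
         exists N, posnat N /\
           forall n, (N <= n)%N -> eps_dense e (evol f n @` U)].
Proof.
have [cX _] := hf.
tfae=> [mix U V oU oV|cof U e oU e0|pre U e oU e0|im U V oU oV].
- have [k [k0 kUV]] := mix U V oU oV.
  apply/cofinite_in_posnatP; exists k => // n /= kn.
  by split; [exact: leq_trans k0 kn|exact: kUV].
(* The preimage of [U] meets [V] exactly when the image of [V] meets [U], so the two sets exchange
   roles in [cof]. *)
- apply/eventually_posnatP; move: e e0; apply/eventually_eps_denseP => // V oV.
  have /cofinite_in_posnatP := cof V U oV oU.
  by apply: filterS => n [_ /setI_preimage_nonempty].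
- apply/eventually_posnatP; move: e e0; apply/eventually_eps_denseP => // V oV.
  (* The density criterion is used twice: for images of [U] tested on [V], and here for preimages of
     [V] tested on [U]. *)
  have : \forall n \near \oo, (evol f n @^-1` V) `&` U !=set0.
    move: U oU; apply/eventually_eps_denseP => // e e0.
    exact/eventually_posnatP/pre.
  by apply: filterS => n /setI_preimage_nonempty.
- apply/eventually_posnatP; move: V oV.
  by apply/eventually_eps_denseP => // e e0; exact/eventually_posnatP/im.
Qed.
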